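(* There exists an infinite word $\mathbf{x}$ that is factor-balanced and has exponential-growth factor complexity. In particular, the symbolic dynamical system generated by $\mathbf{x}$ has positive topological entropy and thus cannot have pure discrete spectrum.
   Context: For a finite word $w$, $|u|_w$ is the number of (possibly overlapping) occurrences of $w$ in $u$. An infinite word $\mathbf{x}$ is factor-balanced if for each finite word $w$ there is a constant $C_w>0$ with $\big||u|_w-|v|_w\big|\le C_w$ for all factors $u,v$ of $\mathbf{x}$ of equal length. The factor complexity $p_{\mathbf{x}}(n)$ is the number of distinct length-$n$ factors of $\mathbf{x}$; exponential growth means $\lim_{n\to\infty}\frac1n\log p_{\mathbf{x}}(n)>0$. The symbolic dynamical system generated by $\mathbf{x}$ is the closure of the orbit of $\mathbf{x}$ under the shift map. *)

(* Defs.v *)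
From HB Require Import structures.
From mathcomp Require Import all_boot all_order all_algebra.
From mathcomp Require Import complex.
From mathcomp Require Import all_classical all_reals all_analysis.

Set Implicit Arguments.
Unset Strict Implicit.
Unset Printing Implicit Defensive.

Import Order.TTheory GRing.Theory Num.Theory numFieldNormedType.Exports.

Local Open Scope classical_set_scope.
Local Open Scope ring_scope.

(** A non-empty finite alphabet. The base point is irrelevant: it is only there
    because MathComp-Analysis requires measurable types to be pointed. *)
#[short(type="alphabetType")]
HB.structure Definition Alphabet := {A of Finite A & Pointed A}.

(** Infinite words are one-sided: [x : nat -> A]. *)
Section Words.
Context {A : alphabetType}.
Implicit Types (x : nat -> A) (u v w : seq A).

Definition is_factor x u : Prop :=
  exists i : nat, u = mkseq (fun k => x (i + k)%N) (size u).

(** [|u|_w]: the number of positions of [u] at which [w] occurs. *)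
Definition occurrences w u : nat :=
  count (fun i => prefix w (drop i u)) (iota 0 (size u).+1).

Definition factor_balanced (R : realType) x : Prop :=
  forall w, exists2 C : R, 0 < C &
    forall u v, is_factor x u -> is_factor x v -> size u = size v ->
      `|(occurrences w u)%:R - (occurrences w v)%:R| <= C.

Definition complexity x (n : nat) : nat :=
  #|[pred u : n.-tuple A | `[< is_factor x u >]]|.

Definition exponential_complexity (R : realType) x : Prop :=
  exists2 h : R, 0 < h &
    (fun n => n%:R^-1 * ln (complexity x n)%:R) @ \oo --> h.

End Words.

(** [A^nat] with the product of the discrete topologies. *)
Definition fullshift (A : alphabetType) : Type :=
  prod_topology (fun _ : nat => discrete_topology A).

HB.instance Definition _ (A : alphabetType) := Pointed.on (fullshift A).
HB.instance Definition _ (A : alphabetType) := Nbhs.on (fullshift A).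
HB.instance Definition _ (A : alphabetType) := Topological.on (fullshift A).

Definition word_shift {A : alphabetType} (y : fullshift A) : fullshift A :=
  fun n => y n.+1.

Definition subshift {A : alphabetType} (x : fullshift A) : set (fullshift A) :=
  closure (range (fun n => iter n word_shift x)).

(** Adler-Konheim-McAndrew entropy of the restriction of [S] to an
    [S]-invariant compact set [X]; open covers of [X] are families of open
    subsets of the ambient space. *)
Section TopologicalEntropy.
Context (R : realType) {T : topologicalType}.
Implicit Types (X : set T) (S : T -> T) (U : set (set T)).

Definition open_cover X U : Prop :=
  (forall O, U O -> open O) /\ X `<=` \bigcup_(O in U) O.

(** The minimal cardinality of a subcover; the set below is a non-empty set of
    natural numbers when [X] is compact and [U] is an open cover of [X]. *)
Definition cover_number X U : R :=
  inf [set k%:R | k in [set k : nat | exists F : 'I_k -> set T,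
    (forall i, U (F i)) /\ X `<=` \bigcup_i F i]].

(** [U \/ S^-1 U \/ ... \/ S^-(n-1) U] *)
Definition iterated_join S U (n : nat) : set (set T) :=
  [set O | exists2 F : nat -> set T, (forall i, (i < n)%N -> U (F i)) &
    O = \bigcap_(i in `I_n) (iter i S @^-1` F i)].

(** For an open cover this is a limit, by subadditivity. *)
Definition cover_entropy X S U : \bar R :=
  limn_esup (fun n =>
    (n%:R^-1 * ln (cover_number X (iterated_join S U n)))%:E).

Definition topological_entropy X S : \bar R :=
  ereal_sup [set cover_entropy X S U | U in open_cover X].

End TopologicalEntropy.

(** Spectrum of the Koopman operator [f |-> f \o S] on [L^2(mu; C)], elements of
    which are represented by square-integrable functions with values in
    [R[i]]. *)
Section Spectrum.
Context {R : realType} {d : measure_display} {T : measurableType d}.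
Variables (mu : probability T R) (S : T -> T).
Implicit Types f g : T -> R[i].

Definition invariant_measure : Prop :=
  forall B : set T, measurable B -> mu (S @^-1` B) = mu B.

Definition sqnormc (z : R[i]) : R := complex.Re z ^+ 2 + complex.Im z ^+ 2.

Definition L2C f : Prop :=
  [/\ measurable_fun setT (fun y => complex.Re (f y)),
      measurable_fun setT (fun y => complex.Im (f y)) &
      (\int[mu]_y (sqnormc (f y))%:E < +oo)%E].

Definition eigenfunction (lambda : R[i]) f : Prop :=
  [/\ L2C f, ~ {ae mu, forall y, f y = 0} &
      {ae mu, forall y, f (S y) = lambda * f y}].

(** The eigenfunctions span a dense subspace of [L^2(mu; C)]. *)
Definition pure_discrete_spectrum : Prop :=
  forall f, L2C f -> forall eps : R, 0 < eps ->
  exists (n : nat) (g : 'I_n -> T -> R[i]) (c : 'I_n -> R[i]),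
    (forall k, exists lambda, eigenfunction lambda (g k)) /\
    (\int[mu]_y (sqnormc (f y - \sum_(k < n) c k * g k y))%:E < eps%:E)%E.

End Spectrum.

(** [fullshift A] with its Borel sigma-algebra. *)
Definition borel_fullshift (A : alphabetType) :=
  g_sigma_algebraType (@open (fullshift A)).

(** Invariant Borel probability measures of the system generated by [x] are
    represented as invariant Borel probability measures on [A^nat] giving full
    mass to [subshift x]. *)
Definition subshift_pure_discrete_spectrum (R : realType) {A : alphabetType}
    (x : fullshift A) : Prop :=
  exists mu : probability (borel_fullshift A) R,
    [/\ invariant_measure mu word_shift, mu (subshift x) = 1%E &
        pure_discrete_spectrum mu word_shift].

(* Main.v *)
(** Starting from the letters, let the words of level [n + 1] be the
    concatenations of a fixed word of level [n] and of all the words of level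
    [n] in an arbitrary order. If there are [k] words of length [L] at level
    [n], there are [k`!] words of length [(k + 1) L] at level [n + 1], and the
    loss [ln k / L - ln k`! / ((k + 1) L)] is summable, so that the limit word
    has exponential complexity for a large enough alphabet. A word occurs the
    same number of times in any two aligned blocks of a high enough level: such
    blocks contain the same words of the previous level, each of them followed
    by the same prefix. Hence the limit word is factor-balanced.

    For any invariant measure, let [n] be a level and [q] be much smaller than
    the number of words of level [n]. Two letters at distance [q L] lie most
    often at the same position of two different words of level [n], and all
    pairs of different words appear equally often; so these letters differ
    with a probability bounded below independently of [n] and [q]. If the
    spectrum were pure discrete, then among the multiples [q L] with [q]
    bounded there would be one for which [f \o S^(q L)] is [L^2]-close to [f],
    where [f y] depends only on the letter [y 0]. *)

From HB Require Import structures.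
Require Import Defs.
From mathcomp Require Import all_boot all_order all_algebra all_fingroup.
From mathcomp Require Import complex zify ring lra.
Set Implicit Arguments.
Unset Strict Implicit.
Unset Printing Implicit Defensive.

(** * Hierarchy of permutations *)

Section PermutationSums.
Variable T : finType.
Implicit Types (G : T -> nat) (D : T -> T -> nat) (s : {perm T}).

Lemma card_perms : #|{: {perm T}}| = #|T|`!.
Proof.
rewrite -[#|T|](eq_card (in_set predT)) -card_perm.
by apply: eq_card => s; rewrite !inE; apply/esym/subsetP => i; rewrite !inE.
Qed.

(** Composing with a transposition shows that the sum over [s] does not depend on [j]; summed over
    [j] as well, it runs over all values of each [s]. *)
Lemma sum_perm_at G j :
  #|T| * \sum_(s : {perm T}) G (s j) = #|T|`! * \sum_i G i.
Proof.
have sym i : \sum_(s : {perm T}) G (s i) = \sum_(s : {perm T}) G (s j).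
  rewrite (reindex_inj (mulgI (tperm i j))) /=.
  by apply: eq_bigr => s _; rewrite permM tpermL.
rewrite -sum_nat_const.
under eq_bigr => i _ do rewrite -(sym i).
rewrite exchange_big /=.
have inv s : \sum_i G (s i) = \sum_i G i by rewrite [RHS](reindex_inj (@perm_inj _ s)).
by rewrite (eq_bigr _ (fun s _ => inv s)) sum_nat_const card_perms.
Qed.

(** For a random [s], the pair [(s j, s j')] is uniform among pairs of distinct elements. As [D]
    vanishes on the diagonal, the right-hand side may run over all pairs. *)
Lemma sum_perm_at2 D j j' : (forall i, D i i = 0) -> j != j' ->
  #|T| * #|T|.-1 * \sum_(s : {perm T}) D (s j) (s j') =
  #|T|`! * \sum_i \sum_i' D i i'.
Proof.
move=> D0 jj'.
have sym i i' : i != i' ->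
    \sum_(s : {perm T}) D (s i) (s i') = \sum_(s : {perm T}) D (s j) (s j').
  (* The first transposition sends [i] to [j]; the second sends the image of [i'] to [j'] and fixes
     [j]. *)
  move=> ii'; pose t := (tperm i j * tperm (tperm i j i') j')%g.
  have ti : t i = j.
    rewrite permM tpermL tpermD //; last by rewrite eq_sym.
    by rewrite -{2}(tpermL i j) (inj_eq perm_inj) eq_sym.
  have ti' : t i' = j' by rewrite permM tpermL.
  rewrite (reindex_inj (mulgI t)) /=.
  by apply: eq_bigr => s _; rewrite !(permM t) ti ti'.
have -> : #|T| * #|T|.-1 * \sum_(s : {perm T}) D (s j) (s j') =
    \sum_i \sum_i' \sum_(s : {perm T}) D (s i) (s i').
  rewrite -mulnA -sum_nat_const; apply: eq_bigr => i _.
  rewrite (bigD1 i) //= [X in _ = X + _]big1 ?add0n; last by move=> s _; exact: D0.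
  under eq_bigr => i' ii' do rewrite sym 1?eq_sym //.
  by rewrite sum_nat_const; congr (_ * _); rewrite cardC1.
under eq_bigr => i _ do rewrite exchange_big /=.
rewrite exchange_big /=.
have inv s : \sum_i \sum_i' D (s i) (s i') = \sum_i \sum_i' D i i'.
  rewrite [RHS](reindex_inj (@perm_inj _ s)) /=.
  by apply: eq_bigr => i _; rewrite [RHS](reindex_inj (@perm_inj _ s)).
by rewrite (eq_bigr _ (fun s _ => inv s)) sum_nat_const card_perms.
Qed.

End PermutationSums.

Lemma sum_ord_mul k L (F : nat -> nat) :
  \sum_(p < k * L) F p = \sum_(b < k) \sum_(r < L) F (b * L + r).
Proof.
elim: k => [|k IH]; first by rewrite !big_ord0.
by rewrite big_ord_recr /= -IH mulSnr big_split_ord.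
Qed.

Lemma ltn_mulD k L b r : b < k -> r < L -> b * L + r < k * L.
Proof. nia. Qed.

(** * The hierarchy of levels and its limit word *)

Section Levels.
Variable A : finType.

(* A level is a finite set of words of common length [len], the word of index
   [i] being the restriction of [word i] to [[0, len)]. *)
Record level := Level {
  idx :> finType; base : idx; len : nat; word : idx -> nat -> A }.

Definition subwords (l : level) (s : {perm l}) : seq l :=
  base l :: [seq s j | j <- enum l].

(** A permutation is an order of the words of [l], whence the index type. The quotient of [p] by
    [len l] numbers the subword, the remainder is the place in it. *)
Definition next_level (l : level) : level :=
  @Level {perm l} 1%g (#|l|.+1 * len l)
    (fun s p => word (nth (base l) (subwords s) (p %/ len l)) (p %% len l)).

(** Makes the number of indices a number of distinct words, for the lower bound on the
    complexity. *)
Definition separated (l : level) := forall i j : l,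
  (forall r, r < len l -> word i r = word j r) -> i = j.

Lemma size_subwords (l : level) (s : {perm l}) : size (subwords s) = #|l|.+1.
Proof. by rewrite /= size_map -cardE. Qed.

Lemma word_next (l : level) (s : next_level l) b r : r < len l ->
  word s (b * len l + r) = word (nth (base l) (subwords s) b) r.
Proof.
move=> rl; have l0 : 0 < len l by case: (len l) rl.
by rewrite /= divnMDl // modnMDl divn_small // modn_small // addn0.
Qed.

(** Whatever the order [s], each word appears exactly once after the leading [base l]. That the
    result is the same for all [s] is the source of balance. *)
Lemma sum_subwords (l : level) (s : {perm l}) (G : l -> nat) :
  \sum_(b < #|l|.+1) G (nth (base l) (subwords s) b) = G (base l) + \sum_i G i.
Proof.
rewrite -(size_subwords s) -(big_mkord xpredT (fun b => G (nth (base l) (subwords s) b))).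
rewrite -(big_nth (base l) xpredT) big_cons big_map big_enum /=.
by rewrite [in RHS](reindex_inj (@perm_inj _ s)).
Qed.

(** The successor skips the leading base word. *)
Lemma nth_subwords (l : level) (s : {perm l}) (i : l) :
  nth (base l) (subwords s) (enum_rank i).+1 = s i.
Proof. by rewrite /= (nth_map i) -?cardE ?ltn_ord // nth_enum_rank. Qed.

Lemma separated_next (l : level) : separated l -> separated (next_level l).
Proof.
move=> sl s t st; apply/permP => i; apply: sl => r rl.
have := st ((enum_rank i).+1 * len l + r).
rewrite !word_next // !nth_subwords; apply.
by apply: ltn_mulD => //; rewrite ltnS ltn_ord.
Qed.

Variable a0 : A.

Fixpoint lev n : level := if n is n'.+1 then next_level (lev n') else @Level A a0 1 (fun c _ => c).

Lemma separated_lev n : separated (lev n).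
Proof. by elim: n => [i j /(_ 0 isT)|n IH] //; apply: separated_next. Qed.

Lemma len_levS n : len (lev n.+1) = #|lev n|.+1 * len (lev n).
Proof. by []. Qed.

Lemma card_levS n : #|lev n.+1| = #|lev n|`!.
Proof. exact: card_perms. Qed.

Lemma card_lev_gt0 n : 0 < #|lev n|.
Proof. by apply/card_gt0P; exists (base (lev n)). Qed.

Lemma len_lev_gt n : n < len (lev n).
Proof.
elim: n => // n IH; rewrite len_levS.
by have := card_lev_gt0 n; nia.
Qed.

Lemma len_lev_gt0 n : 0 < len (lev n).
Proof. by rewrite (leq_ltn_trans _ (len_lev_gt n)). Qed.

Lemma len_lev_le m n : m <= n -> len (lev m) <= len (lev n).
Proof.
move=> /subnK <-; elim: (n - m) => // d IH.
by rewrite (leq_trans IH) // addSn len_levS leq_pmull.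
Qed.

Lemma word_prefix n (s : lev n.+1) r : r < len (lev n) ->
  word s r = word (base (lev n)) r.
Proof.
move=> rl; rewrite -[r in LHS](add0n r) -[X in word _ (X + _)](mul0n (len (lev n))).
by rewrite word_next.
Qed.

Lemma word_base m n p : m <= n -> p < len (lev m) ->
  word (base (lev n)) p = word (base (lev m)) p.
Proof.
move=> /subnK <- pm; elim: (n - m) => // d IH.
by rewrite addSn word_prefix ?IH // (leq_trans pm) // len_lev_le // leq_addl.
Qed.

(** Base words of successive levels extend each other ([word_base]), and those of level [p] are long
    enough to have a position [p] ([len_lev_gt]). *)
Definition limit_word p := word (base (lev p)) p.
Local Notation x := limit_word.

Lemma limit_wordE n p : p < len (lev n) -> x p = word (base (lev n)) p.
Proof.
move=> pn; rewrite /x; case: (leqP n p) => [np|/ltnW pn'].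
  by rewrite (word_base np).
by rewrite (word_base pn') // len_lev_gt.
Qed.

(** Induction on [m - n]: the length of a subword of [s] is a multiple [t] of [len (lev n)], so
    block [b] is block [b %% t] of subword [b %/ t]. *)
Lemma word_aligned n m (s : lev m) b : n <= m ->
  b.+1 * len (lev n) <= len (lev m) ->
  exists i : lev n, forall r, r < len (lev n) ->
    word s (b * len (lev n) + r) = word i r.
Proof.
move=> /subnK e; move: e s; move: (m - n) => d <- {m}.
elim: d b => [|d IH] b s.
  rewrite -[X in _ <= X -> _](mul1n (len (lev n))) leq_pmul2r ?len_lev_gt0 //.
  by rewrite ltnS leqn0 => /eqP ->; exists s.
have [t et] : exists t, len (lev (d + n)) = t * len (lev n).
  by elim: d {IH s} => [|d [t et]]; [exists 1; rewrite mul1n|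
    exists (#|lev (d + n)|.+1 * t); rewrite addSn len_levS et mulnA].
have t0 : 0 < t by have := len_lev_gt0 (d + n); rewrite et; case: (t).
move=> bl; have [i hi] := IH (b %% t) (nth (base (lev (d + n))) (subwords s) (b %/ t))
  ltac:(by rewrite et leq_pmul2r ?len_lev_gt0 // ltn_mod).
exists i => r rn; rewrite -hi // {1}(divn_eq b t) mulnDl -mulnA -et -addnA.
rewrite word_next // et -ltn_subRL.
have := ltn_mod b t; rewrite t0 => h; nia.
Qed.

Lemma limit_word_aligned n b : exists i : lev n, forall r, r < len (lev n) ->
  x (b * len (lev n) + r) = word i r.
Proof.
(* Words of level [N] are longer than [N], so the base word of that level covers block [b]
   entirely. *)
pose N := b.+1 * len (lev n).
have nN : n <= N by have := len_lev_gt n; nia.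
have NN := ltnW (len_lev_gt N).
have [i hi] := word_aligned (base (lev N)) nN NN.
exists i => r rn; rewrite -hi //; apply: limit_wordE.
apply: leq_trans NN; rewrite /N; nia.
Qed.

(** The base word of level [n.+1] is a prefix of the limit word and, being given by the identity
    permutation, contains every word of level [n]. *)
Lemma word_in_limit_word n (i : lev n) :
  exists s, forall r, r < len (lev n) -> x (s + r) = word i r.
Proof.
exists ((enum_rank i).+1 * len (lev n)) => r rl.
rewrite (@limit_wordE n.+1) ?word_next ?nth_subwords ?perm1 //.
by rewrite len_levS; apply: ltn_mulD => //; rewrite ltnS ltn_ord.
Qed.

End Levels.

Lemma double_lt_fact k : 3 < k -> 2 * k.+1 <= k`!.
Proof.
elim: k => // k IH; rewrite ltnS leq_eqVlt => /orP[/eqP <- //|/[dup] k3 /IH].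
by rewrite factS => h; apply: leq_trans (leq_mul (leqnn k.+1) h); nia.
Qed.

Lemma sum_ord_leq m n (F : nat -> nat) : m <= n ->
  \sum_(i < m) F i <= \sum_(i < n) F i.
Proof. by move=> /subnKC <-; rewrite big_split_ord leq_addr. Qed.

(** The window at [s] lies within [m %/ P + 2] aligned blocks and the sum over the window at [s'] is
    at least that of [m %/ P - 1] blocks; the difference is at most [3 * c <= 3 * P]. *)
Lemma window_sum_balanced (g : nat -> nat) P c s s' m :
  0 < P -> (forall i, g i <= 1) ->
  (forall b, \sum_(p < P) g (b * P + p) = c) ->
  \sum_(i < m) g (s + i) <= \sum_(i < m) g (s' + i) + 3 * P.
Proof.
move=> P0 g1 gc; pose F n := \sum_(i < n) g i.
have FD a n : F (a + n) = F a + \sum_(i < n) g (a + i) by rewrite /F big_split_ord.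
have FP b : F (b * P) = b * c.
  rewrite /F (sum_ord_mul _ _ g) (eq_bigr (fun=> c)) ?sum_nat_const ?card_ord //.
have Fle a b : a <= b -> F a <= F b by exact: sum_ord_leq.
have cP : c <= P.
  rewrite -(gc 0); apply: leq_trans (leq_sum _ (fun i _ => g1 _)) _.
  by rewrite sum_nat_const card_ord muln1.
have floor a : a %/ P * P <= a by rewrite leq_trunc_div.
have ceil a : a <= (a %/ P).+1 * P by rewrite ltnW // ltn_ceil.
have := FD s m; have := FD s' m.
have := Fle _ _ (floor s); have := Fle _ _ (ceil s'); rewrite !FP.
have : F (s + m) <= (s %/ P + m %/ P + 2) * c.
  rewrite -FP; apply: Fle; have := ceil s; have := ceil m; nia.
have : (s' %/ P + m %/ P) * c <= F (s' + m).
  rewrite -FP; apply: Fle; have := floor s'; have := floor m; nia.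
nia.
Qed.

(** * Balance of the limit word *)

Section LimitWord.
Variables (A : finType) (a0 : A).
Local Notation lev := (lev a0).
Local Notation x := (limit_word a0).

(* A level-[n.+1] word starts with the base word of level [n]. Hence the
   occurrences of a word of length at most [len (lev n)] starting inside an
   aligned level-[n.+1] block are determined by the index of that block. *)
Lemma limit_word_block_sum n (w : seq A) : size w <= len (lev n) -> exists c, forall b,
  \sum_(p < len (lev n.+2)) (mkseq (fun t => x (b * len (lev n.+2) + p + t)) (size w) == w) = c.
Proof.
move=> wn; pose l := lev n.+1; pose L := len l.
pose ext (i : l) t := if t < L then word i t else word (base (lev n)) (t - L).
pose m (i : l) := \sum_(r < L) (mkseq (fun t => ext i (r + t)) (size w) == w).
exists (m (base l) + \sum_i m i) => b.
have [s hs] := limit_word_aligned a0 n.+2 b.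
rewrite -(sum_subwords s m) len_levS -/l -/L.
rewrite (sum_ord_mul _ _ (fun p => (mkseq (fun t => x (b * (#|l|.+1 * L) + p + t)) (size w) == w) : nat)).
apply: eq_bigr => c _; apply: eq_bigr => r _; congr (nat_of_bool (_ == w)).
apply/eq_in_map => t; rewrite mem_iota add0n => /andP[_ tw].
have rL := ltn_ord r; have cl := ltn_ord c.
rewrite /ext; case: ifP => rt.
  rewrite -addnA -addnA hs ?word_next //.
  exact: ltn_mulD.
(* The following block may belong to the next block of level [n.+2], but only its first
   [len (lev n)] letters are read, and these are the same in all blocks. *)
have [i hi] := limit_word_aligned a0 n.+1 (b * #|l|.+1 + c.+1).
have tn : r + t - L < len (lev n) by rewrite ltn_subLR; [lia | rewrite leqNgt rt].
have nL : len (lev n) <= L by apply: len_lev_le.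
rewrite -(word_prefix i) // -hi; last exact: leq_trans nL.
congr x; move/negbT: rt; rewrite -leqNgt -/l -/L; nia.
Qed.

Lemma limit_word_balanced (w : seq A) : exists C, forall s s' m,
  \sum_(i < m) (mkseq (fun t => x (s + i + t)) (size w) == w) <=
  \sum_(i < m) (mkseq (fun t => x (s' + i + t)) (size w) == w) + C.
Proof.
have [c hc] := limit_word_block_sum (ltnW (len_lev_gt a0 (size w))).
exists (3 * len (lev (size w).+2)) => s s' m.
apply: (window_sum_balanced
  (g := fun i => (mkseq (fun t => x (i + t)) (size w) == w) : nat) s s' m _ _ hc).
- exact: len_lev_gt0.
- by move=> i; case: (_ == _).
Qed.

(** * Frequency of mismatches at a given distance, under a two-valued coding of the letters *)

Variable f : A -> bool.

Definition hamming (l : level A) (i j : l) :=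
  \sum_(r < len l) (f (word i r) != f (word j r)).

Definition hamming_total (l : level A) := \sum_(i : l) \sum_(j : l) hamming i j.

Lemma hamming_refl (l : level A) (i : l) : hamming i i = 0.
Proof. by rewrite /hamming big1 // => r _; rewrite eqxx. Qed.

Lemma hamming_next (l : level A) (s t : next_level l) :
  hamming s t = \sum_(i : l) hamming (s i) (t i).
Proof.
rewrite /hamming (sum_ord_mul _ _ (fun p => (f (word s p) != f (word t p)) : nat)).
rewrite big_ord_recl [X in X + _]big1 ?add0n; last first.
  by move=> r _; rewrite !(@word_next _ l) //= eqxx.
rewrite [RHS](reindex (@enum_val _ l)); last exact/onW_bij/enum_val_bij.
apply: eq_bigr => b _; apply: eq_bigr => r _.
by rewrite lift0 !(@word_next _ l) // -{1 2}(enum_valK b) !nth_subwords.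
Qed.

(** For independent random [s] and [t], each pair [(s i, t i)] is uniform among all pairs of words,
    and the common leading base word contributes nothing. *)
Lemma hamming_total_next (l : level A) : 0 < #|l| ->
  #|l| * hamming_total (next_level l) = #|l|`! ^ 2 * hamming_total l.
Proof.
move=> l0; apply/eqP; rewrite -(eqn_pmul2l l0); apply/eqP.
have -> : hamming_total (next_level l) =
    \sum_(i : l) \sum_(s : {perm l}) \sum_(t : {perm l}) hamming (s i) (t i).
  rewrite [RHS]exchange_big; apply: eq_bigr => s _.
  by rewrite [RHS]exchange_big; apply: eq_bigr => t _; rewrite hamming_next.
have row i : #|l| * (#|l| * \sum_(s : {perm l}) \sum_(t : {perm l}) hamming (s i) (t i)) =
    #|l|`! ^ 2 * hamming_total l.
  have -> : #|l| * \sum_(s : {perm l}) \sum_(t : {perm l}) hamming (s i) (t i) =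
      \sum_(s : {perm l}) #|l|`! * \sum_j hamming (s i) j.
    by rewrite big_distrr /=; apply: eq_bigr => s _; rewrite (sum_perm_at (hamming (s i))).
  rewrite (sum_perm_at (fun j => #|l|`! * \sum_j' hamming j j')).
  by rewrite -big_distrr /= mulnA mulnn.
have distr (F : l -> nat) : #|l| * (#|l| * \sum_i F i) = \sum_i #|l| * (#|l| * F i).
  by rewrite 2!big_distrr.
by rewrite distr (eq_bigr _ (fun i _ => row i)) sum_nat_const.
Qed.

Hypothesis A4 : 3 < #|A|.
Hypothesis f_nonconst : exists c d, f c != f d.

Lemma card_lev_gt3 n : 3 < #|lev n|.
Proof.
elim: n => // n IH; rewrite card_levS (leq_trans IH) //.
by case: #|_| IH => // k _; rewrite factS leq_pmulr ?fact_gt0.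
Qed.

(* The summand [len (lev n)] on the right absorbs the loss of a factor
   [k / k.+1] at each step. *)
Lemma hamming_total_lb n :
  (#|lev n| + 2) * #|lev n| * len (lev n) <= 2 * #|A| ^ 2 * hamming_total (lev n).
Proof.
elim: n => [|n IH].
  have h0 : 0 < hamming_total (lev 0).
    have [c [d cd]] := f_nonconst.
    rewrite /hamming_total (bigD1 c) //= (bigD1 d) //= /hamming big_ord1 cd.
    by rewrite -!addnA.
  move: h0; rewrite muln1 -mulnn -[#|lev 0|]/(#|A|); move: A4.
  move: #|A| (hamming_total _) => k E k3 E0.
  have h1 : (k + 2) * k <= 2 * (k * k) by nia.
  by apply: leq_trans h1 _; rewrite leq_pmulr.
have k3 := card_lev_gt3 n; have kf := double_lt_fact k3.
have k0 : 0 < #|lev n| by apply: card_lev_gt0.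
have := hamming_total_next k0; rewrite card_levS len_levS.
have -> : next_level (lev n) = lev n.+1 by [].
move: IH k0 kf; set k := #|lev n|; set L := len _; set E := hamming_total (lev n).
set E' := hamming_total _; set K := k`!; set a := #|A| ^ 2 => IH k0 kf EE.
rewrite -(leq_pmul2l k0) [leqRHS]mulnCA EE.
(* This amounts to [2 * k.+1 <= K], that is [kf]. *)
have h1 : (K + 2) * k.+1 <= K * (k + 2) by nia.
have := leq_mul (leqnn (K ^ 2)) IH; have := leq_mul h1 (leqnn (k * K * L)).
rewrite -mulnn; lia.
Qed.

Definition mismatches (m N : nat) (y : nat -> A) := \sum_(i < N) (f (y i) != f (y (i + m))).

(** A shift by [q * len (lev n)] carries each subword onto the one [q] places further, offset by
    offset. The leading base word is dropped, so that only permuted words are compared. *)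
Lemma mismatches_word n q (s : lev n.+1) :
  \sum_(b < #|lev n| - q) hamming (nth (base (lev n)) (subwords s) b.+1)
     (nth (base (lev n)) (subwords s) (b.+1 + q)) <=
  mismatches (q * len (lev n)) (len (lev n.+1) - q * len (lev n)) (word s).
Proof.
set k := #|_|; set L := len (lev n).
have -> : len (lev n.+1) - q * L = (k.+1 - q) * L by rewrite mulnBl.
rewrite /mismatches (sum_ord_mul _ _ (fun i => (f (word s i) != f (word s (i + q * L))) : nat)).
case: (leqP q k) => [qk|kq]; last first.
  by have -> : k - q = 0 by [lia]; rewrite big_ord0.
rewrite subSn // [leqRHS]big_ord_recl; apply: leq_trans _ (leq_addl _ _).
apply: leq_sum => b _; apply: leq_sum => r _.
by rewrite lift0 addnAC -mulnDl !(@word_next _ (lev n)).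
Qed.

(** In a random [s], two permuted subwords [q] places apart form a uniform pair of distinct words,
    whose mean Hamming distance is bounded below by [hamming_total_lb]. The bound on [q] leaves at
    least half of the places. *)
Lemma sum_mismatches_word n q : 0 < q -> 2 * q <= #|lev n| ->
  #|lev n|`! * #|lev n| * len (lev n) <=
  4 * #|A| ^ 2 * \sum_(s : lev n.+1)
    mismatches (q * len (lev n)) (len (lev n.+1) - q * len (lev n)) (word s).
Proof.
move=> q0 qk; set l := lev n; set k := #|l|; set a := #|A| ^ 2; set K := k`!.
set S := \sum_(s : _) _.
rewrite -/l -/k in qk; have k3 : 3 < k := card_lev_gt3 n.
have : (k - q) * (K * hamming_total l) <= k * k.-1 * S.
  apply: (@leq_trans (k * k.-1 * \sum_(b < k - q) \sum_(s : {perm l})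
     hamming (nth (base l) (subwords s) b.+1) (nth (base l) (subwords s) (b.+1 + q)))).
    rewrite [leqRHS]big_distrr -[X in X * _](card_ord (k - q)) -sum_nat_const /=.
    apply: leq_sum => b _.
    have bk : b < k by have := ltn_ord b; lia.
    have bqk : b + q < k by have := ltn_ord b; lia.
    pose i : l := enum_val (Ordinal bk); pose j : l := enum_val (Ordinal bqk).
    have ij : i != j.
      by apply/eqP => /enum_val_inj /(congr1 val) /=; lia.
    rewrite -(sum_perm_at2 (@hamming_refl l) ij); apply: eq_leq; congr (_ * _).
    apply: eq_bigr => s _; congr hamming.
      by rewrite -(nth_subwords s i) /i enum_valK.
    by rewrite -(nth_subwords s j) /j enum_valK.
  rewrite leq_mul2l exchange_big /=; apply/orP; right.
  by apply: leq_sum => s _; apply: mismatches_word.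
have := hamming_total_lb n; rewrite -/l -/k -/a.
move: S (hamming_total l) (len l) => S E L h1 h2.
have k0 : 0 < k * k.-1 by nia.
rewrite -(leq_pmul2l k0).
have h3 := leq_mul (leqnn (4 * a)) h2.
have h4 := leq_mul (leqnn (2 * (k - q) * K)) h1.
have h5 : k * k.-1 <= 2 * (k - q) * (k + 2).
  have kq : k <= 2 * (k - q) by lia.
  by rewrite leq_mul //; lia.
move: (leq_mul h5 (leqnn (K * k * L))) h3 h4; clear.
move: k.-1 (k - q) => k1 kq; lia.
Qed.

(** A window of twice the length of a level-[n.+2] block contains an aligned such block, in which
    every word of level [n.+1] occurs; so the sum over all these words applies to every window. *)
Lemma mismatches_lb n q s : 0 < q -> 2 * q <= #|lev n| ->
  2 * len (lev n.+2) <= 32 * #|A| ^ 2 *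
    mismatches (q * len (lev n)) (2 * len (lev n.+2)) (fun i => x (s + i)).
Proof.
move=> q0 qk; set P := len (lev n.+2); set m := q * _.
(* Block [b] is the first aligned one that starts after [s]. *)
set a := #|A| ^ 2; set b := (s %/ P).+1.
have P0 : 0 < P by apply: len_lev_gt0.
set g := fun p => (f (x p) != f (x (p + m))) : nat.
pose S := \sum_(t : lev n.+1) mismatches m (len (lev n.+1) - m) (word t).
have -> : mismatches m (2 * P) (fun i => x (s + i)) = \sum_(i < 2 * P) g (s + i).
  by apply: eq_bigr => i _; rewrite addnA.
have le1 : \sum_(p < P) g (b * P + p) <= \sum_(i < 2 * P) g (s + i).
  have e : b * P = s + (P - s %% P).
    by rewrite /b {2}(divn_eq s P); have := ltn_pmod s P0; nia.
  have le : (P - s %% P) + P <= 2 * P by lia.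
  have := sum_ord_leq (fun i => g (s + i)) le; apply: leq_trans.
  rewrite [leqRHS]big_split_ord /=; apply: leq_trans _ (leq_addl _ _).
  by apply: eq_leq; apply: eq_bigr => p _; rewrite e addnA.
have le2 : S <= \sum_(p < P) g (b * P + p).
  have [t ht] := limit_word_aligned a0 n.+2 b; rewrite -/P in ht.
  rewrite (sum_ord_mul #|lev n.+1|.+1 (len (lev n.+1)) (fun p => g (b * P + p))).
  pose G (u : lev n.+1) := mismatches m (len (lev n.+1) - m) (word u).
  have -> : S = \sum_(u : lev n.+1) G u by [].
  apply: leq_trans (leq_addl (G (base (lev n.+1))) _) _.
  rewrite -(sum_subwords t G); apply: leq_sum => c _.
  (* Dropping the last [m] positions of each subword keeps both compared letters inside it. *)
  have := sum_ord_leq (fun r => g (b * P + (c * len (lev n.+1) + r)))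
    (leq_subr m (len (lev n.+1))).
  apply: leq_trans.
  rewrite /G /mismatches; apply: leq_sum => r _.
  have r1 : r < len (lev n.+1) by have := ltn_ord r; lia.
  have r2 : r + m < len (lev n.+1) by have := ltn_ord r; lia.
  have hc p : p < len (lev n.+1) -> x (b * P + (c * len (lev n.+1) + p)) =
      word (nth (base (lev n.+1)) (subwords t) c) p.
    by move=> pl; rewrite ht ?(@word_next _ (lev n.+1)) //; apply: ltn_mulD.
  have e : b * P + (c * len (lev n.+1) + r) + m = b * P + (c * len (lev n.+1) + (r + m)) by lia.
  by rewrite /g e (hc _ r1) (hc _ r2).
have := sum_mismatches_word q0 qk; rewrite -/m -/a -/S => le3.
(* With [k] words of length [L] at level [n] and [K = k!], one has [P = (K + 1) (k + 1) L], so
   [2 P <= 8 K k L]. *)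
apply: (@leq_trans (8 * (4 * a * S))); last first.
  have := leq_trans le2 le1; set X := \sum_(i < _) _; nia.
apply: leq_trans (leq_mul (leqnn 8) le3).
rewrite /P len_levS card_levS len_levS !mulnA leq_mul //.
have h k K : 0 < k -> 0 < K -> 2 * K.+1 * k.+1 <= 8 * K * k by nia.
by apply: h; rewrite ?fact_gt0 ?card_lev_gt0.
Qed.

End LimitWord.

From mathcomp Require Import all_classical all_reals all_analysis.
From mathcomp Require Import measurable_realfun.
Import Order.TTheory GRing.Theory Num.Theory numFieldNormedType.Exports.
Local Open Scope classical_set_scope.
Local Open Scope ring_scope.

(** * Growth of the complexity *)

Section Fekete.
Context {R : realType}.
Variable u : nat -> R.
Hypothesis u_ge0 : forall n, 0 <= u n.
Hypothesis u_subadd : forall m n, u (m + n)%N <= u m + u n.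

(** The shift leaves out the index [0], where the quotient would be [0] by convention. *)
Definition mean_inf : R := inf [set n.+1%:R^-1 * u n.+1 | n in setT].

Lemma mean_inf_lb n : (0 < n)%N -> mean_inf <= n%:R^-1 * u n.
Proof.
case: n => // n _; apply: ge_inf; last by exists n.
by exists 0 => _ [m _ <-]; rewrite mulr_ge0 ?invr_ge0.
Qed.

(** The sum over all [i < m] bounds the remainder term [u (n %% m)] uniformly in [n]. *)
Lemma subadditive_quotient m n : (0 < m)%N ->
  u n <= (n %/ m)%:R * u m + \sum_(i < m) u i.
Proof.
move=> m0; have um k r : u (k * m + r)%N <= k%:R * u m + u r.
  elim: k => [|k IH]; first by rewrite mul0n add0n mul0r add0r.
  by rewrite mulSn -addnA -natr1; have := u_subadd m (k * m + r); lra.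
rewrite {1}(divn_eq n m) (le_trans (um _ _)) // lerD2l.
rewrite (bigD1 (Ordinal (ltn_pmod n m0))) //= lerDl.
by apply: sumr_ge0 => i _.
Qed.

Lemma fekete : (fun n => n%:R^-1 * u n) @ \oo --> mean_inf.
Proof.
apply/cvgrPdist_le => e e0.
have [m m0 um] : exists2 m, (0 < m)%N & m%:R^-1 * u m < mean_inf + e / 2.
  have [||_ [m _ <-] um] := @inf_adherent R [set n.+1%:R^-1 * u n.+1 | n in setT] (e / 2).
  - by rewrite divr_gt0.
  - split; first by exists (1%:R^-1 * u 1%N); exists 0%N.
    by exists 0 => _ [m _ <-]; rewrite mulr_ge0 ?invr_ge0.
  - by exists m.+1.
pose B := \sum_(i < m) u i.
have B0 : 0 <= B by apply: sumr_ge0.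
near=> n.
have n0 : (0 < n)%N by near: n; exists 1%N.
have nB : B <= n%:R * (e / 2).
  rewrite -ler_pdivrMr ?divr_gt0 //; near: n; exact: nbhs_infty_ger.
rewrite ler_distlC; apply/andP; split.
  by rewrite lerBlDr (le_trans (mean_inf_lb n0)) // lerDl ltW.
have nR : 0 < n%:R :> R by rewrite ltr0n.
have mR : 0 < m%:R :> R by rewrite ltr0n.
rewrite mulrC ler_pdivrMr // (le_trans (subadditive_quotient n m0)) // -/B.
have h1 : (n %/ m)%:R * u m <= n%:R * (m%:R^-1 * u m).
  rewrite mulrA ler_wpM2r // ler_pdivlMr // -natrM ler_nat; exact: leq_trunc_div.
have h2 := ler_wpM2l (ltW nR) (ltW um).
lra.
Unshelve. all: by end_near. Qed.

End Fekete.

(** * Counting factors and occurrences *)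

Section Complexity.
Variable A : alphabetType.
Implicit Types x : nat -> A.

Lemma is_factorP x n (u : n.-tuple A) :
  is_factor x u <-> exists i, forall k : 'I_n, tnth u k = x (i + k)%N.
Proof.
split=> [[i ui]|[i ui]]; exists i.
  move=> k; rewrite (tnth_nth (x 0)) {}ui.
  by rewrite nth_mkseq // size_tuple.
apply: (@eq_from_nth _ (x 0)); first by rewrite size_mkseq.
move=> k; rewrite size_tuple => kn; rewrite nth_mkseq ?size_tuple //.
by rewrite -(ui (Ordinal kn)) (tnth_nth (x 0)).
Qed.

Lemma complexity_gt0 x n : (0 < complexity x n)%N.
Proof.
apply/card_gt0P; exists [tuple x k | k < n]; rewrite inE; apply/is_factorP.
by exists 0%N => k; rewrite tnth_mktuple.
Qed.

Lemma complexity_submul x m n :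
  (complexity x (m + n) <= complexity x m * complexity x n)%N.
Proof.
pose g (u : (m + n).-tuple A) :=
  ([tuple tnth u (lshift n k) | k < m], [tuple tnth u (rshift m k) | k < n]).
have gI : injective g.
  move=> u v guv; apply: eq_from_tnth => k; case: (split_ordP k) => j ->.
    by have := congr1 (fun p => tnth p.1 j) guv; rewrite !tnth_mktuple.
  by have := congr1 (fun p => tnth p.2 j) guv; rewrite !tnth_mktuple.
rewrite /complexity -(fintype.card_image gI) -cardX; apply/subset_leq_card/fintype.subsetP => p.
move=> /fintype.imageP[u]; rewrite inE => /is_factorP[i ui] ->.
apply/andP; split; rewrite inE; apply/is_factorP.
  by exists i => k; rewrite tnth_mktuple ui.
by exists (i + m)%N => k; rewrite tnth_mktuple ui /= addnA.
Qed.

Lemma ln_complexity_subadd (R : realType) x m n :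
  ln (complexity x (m + n))%:R <= ln (complexity x m)%:R + ln (complexity x n)%:R :> R.
Proof.
have c0 k : 0 < (complexity x k)%:R :> R by rewrite ltr0n complexity_gt0.
rewrite -lnM ?posrE // ler_ln ?posrE ?mulr_gt0 // -natrM ler_nat.
exact: complexity_submul.
Qed.

Lemma ln_complexity_ge0 (R : realType) x n : 0 <= ln (complexity x n)%:R :> R.
Proof. by rewrite ln_ge0 // ler1n complexity_gt0. Qed.

(** Only starts that leave room for [w] count; the truncated subtraction gives the empty sum when
    [w] is too long. *)
Lemma occurrencesE x (w : seq A) i m :
  occurrences w (mkseq (fun k => x (i + k)%N) m) =
  (\sum_(j < m.+1 - size w) (mkseq (fun t => x (i + j + t)) (size w) == w))%N.
Proof.
rewrite /occurrences size_mkseq -sum1_count -(big_mkord xpredT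
  (fun j => nat_of_bool (mkseq (fun t => x (i + j + t)%N) (size w) == w))).
rewrite -{1}[m.+1]subn0 -/(index_iota 0 m.+1).
rewrite (big_cat_nat (n := (m.+1 - size w)%N)) ?leq_subr //= [X in (_ + X)%N]big1_seq ?addn0.
  rewrite big_mkcond big_nat [RHS]big_nat; apply: eq_bigr => j /andP[_ jm].
  rewrite -[in LHS](mkseq_nth (x 0) (drop _ _)) size_drop size_mkseq prefixE.
  suff -> : take (size w) (mkseq (nth (x 0) (drop j (mkseq (fun k => x (i + k)%N) m))) (m - j)) =
      mkseq (fun t => x (i + j + t)%N) (size w) by case: (_ == _).
  have jw : (size w <= m - j)%N by lia.
  apply: (@eq_from_nth _ (x 0)); first by rewrite size_take !size_mkseq; case: ltngtP jw.
  move=> t; rewrite size_take size_mkseq => tw.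
  have {}tw : (t < size w)%N by move: tw; case: ifP => //; lia.
  rewrite nth_take // !nth_mkseq //; last by lia.
  rewrite nth_drop nth_mkseq ?addnA //; lia.
move=> j; rewrite mem_index_iota => /andP[pj /andP[j1 j2]].
have h : (m - j < size w)%N by move: (j : nat) j1 j2 => k; lia.
case/prefixP: pj => t /(congr1 size); rewrite size_cat size_drop size_mkseq => e.
by have := leq_addr (size t) (size w); rewrite -e leqNgt h.
Qed.


Lemma factor_balancedP (R : realType) x :
  (forall w : seq A, exists C, forall s s' m,
    (\sum_(i < m) (mkseq (fun t => x (s + i + t)) (size w) == w) <=
     \sum_(i < m) (mkseq (fun t => x (s' + i + t)) (size w) == w) + C)%N) ->
  factor_balanced R x.
Proof.
(* The successor makes the constant positive even for [C = 0]. *)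
move=> bal w; have [C hC] := bal w; exists C.+1%:R => // u v [s ->] [s' ->].
rewrite !size_mkseq => <-; rewrite !occurrencesE.
set a := (\sum_(_ < _) _)%N; set b := (\sum_(_ < _) _)%N.
have ab : (a <= b + C)%N := hC _ _ _; have ba : (b <= a + C)%N := hC _ _ _.
rewrite ler_norml lerBlDr lerBrDr addrC -!natrD lerBlDr -natrD !ler_nat; lia.
Qed.

End Complexity.

(** * Exponential growth over a large alphabet *)

Section Growth.
Context {R : realType}.
Variables (A : alphabetType) (a0 : A).
Local Notation lev := (lev a0).
Local Notation x := (limit_word a0).

(** The quotient of [k ^ k] by [k!] is one term of the exponential series at [k]. *)
Lemma expn_le_fact k : k%:R ^+ k <= expR 1 ^+ k * k`!%:R :> R.
Proof.
case: k => [|k]; first by rewrite !expr0 mul1r.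
have := @expR_ge1Dxn R k.+1%:R k (ler0n _ _).
rewrite -ler_pdivrMr ?ltr0n ?fact_gt0 // -expRM_natl mulr1; lra.
Qed.

Hypothesis A_large : 4 * expR 1 <= #|A|%:R :> R.

(* The factor [2 * expR 1] makes the induction go through: it compensates for
   the denominator in [k`! >= (k / expR 1) ^+ k]. *)
Lemma card_lev_growth n : 2 * expR 1 * 2 ^+ len (lev n) <= #|lev n|%:R :> R.
Proof.
elim: n => [|n IH]; first by rewrite expr1; move: A_large; rewrite -[#|lev 0|]/#|A|; lra.
rewrite card_levS len_levS; set k := #|lev n| in IH *; set L := len _ in IH *.
have e0 : 0 < expR 1 :> R := expR_gt0 1.
have h1 : (2 * 2 ^+ L) ^+ k <= k`!%:R :> R.
  rewrite -(ler_pM2l (exprn_gt0 k e0)); apply: le_trans (expn_le_fact k).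
  have g0 : 0 <= expR 1 * (2 * 2 ^+ L) :> R by rewrite ltW // !mulr_gt0 // exprn_gt0.
  rewrite -exprMn; apply: lerXn2r; rewrite ?nnegrE //.
  by rewrite mulrCA mulrA.
(* Of [(2 * 2 ^+ L) ^+ k], the part [2 ^+ k] exceeds [k], hence [2 * expR 1 * 2 ^+ L] by induction;
   the rest is [2 ^+ (k * L)]. *)
apply: le_trans h1; rewrite exprMn -exprM [leRHS]mulrC mulSnr mulnC exprD.
rewrite [leLHS]mulrCA ler_wpM2l ?exprn_ge0 // (le_trans IH) // -natrX ler_nat.
exact/ltnW/ltn_expl.
Qed.

Lemma card_lev_complexity n : (#|lev n| <= complexity x (len (lev n)))%N.
Proof.
pose g (i : lev n) := [tuple word i r | r < len (lev n)].
have gI : injective g.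
  move=> i j gij; apply: separated_lev => r rn.
  by have := congr1 (fun u => tnth u (Ordinal rn)) gij; rewrite !tnth_mktuple.
rewrite /complexity -(fintype.card_codom gI); apply/subset_leq_card/fintype.subsetP => u.
move=> /codomP[i ->]; rewrite inE; apply/is_factorP.
have [s hs] := word_in_limit_word i; exists s => k.
by rewrite tnth_mktuple hs.
Qed.

(** Fekete's lemma gives the limit as an infimum, hence also the bound for each [n] that the entropy
    estimate uses. Along the lengths [len (lev n)] the quotients are at least [ln 2]. *)
Lemma complexity_cvg : exists h : R, [/\ 0 < h,
  (fun n => n%:R^-1 * ln (complexity x n)%:R) @ \oo --> h &
  forall n, (0 < n)%N -> h <= n%:R^-1 * ln (complexity x n)%:R].
Proof.
pose u n : R := ln (complexity x n)%:R.
have u0 n : 0 <= u n := ln_complexity_ge0 R x n.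
have uD m n : u (m + n)%N <= u m + u n := ln_complexity_subadd R x m n.
have uh := fekete u0 uD; exists (mean_inf u); split => //; last exact: mean_inf_lb.
apply: (@lt_le_trans _ _ (ln 2)); first by rewrite ln_gt0 // ltr1n.
have sub : (fun n => (len (lev n))%:R^-1 * u (len (lev n))) @ \oo --> mean_inf u.
  apply: cvg_comp uh => S [N _ NS]; exists N => // n Nn; apply: NS.
  by rewrite /= (leq_trans Nn) // ltnW // len_lev_gt.
apply: (cvgr_to_ge sub); exists 0%N => // n _.
rewrite mulrC ler_pdivlMr ?ltr0n ?len_lev_gt0 // mulr_natr -lnXn ?ltr0n //.
rewrite ler_ln ?posrE ?exprn_gt0 ?ltr0n ?complexity_gt0 //.
apply: (@le_trans _ _ #|lev n|%:R); last by rewrite ler_nat card_lev_complexity.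
apply: le_trans (card_lev_growth n); rewrite ler_peMl ?exprn_ge0 //.
have := @expR_ge1Dx R 1; lra.
Qed.

End Growth.

(** * Topological entropy *)

Section Cylinders.
Variable A : alphabetType.
Implicit Types (x y z : fullshift A).

Lemma open_coordinate n (P : set A) : open [set y : fullshift A | P (y n)].
Proof.
pose X : topologicalType := discrete_topology A.
pose f (y : fullshift A) : X := y n.
have cf : continuous f := @proj_continuous nat (fun=> X) n.
have openf := (continuousP f).1 cf P.
exact: openf (@discrete_open (discrete_topology A) P).
Qed.

Lemma iter_word_shift n y k : iter n word_shift y k = y (n + k)%N.
Proof. by elim: n k => // n IH k; rewrite iterS /word_shift IH addnS. Qed.

Lemma nbhs_prefix n y : nbhs y [set z : fullshift A | forall i, (i < n)%N -> z i = y i].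
Proof.
elim: n => [|n IH]; first by apply: filterS filterT.
have yn : nbhs y [set z : fullshift A | z n = y n].
  by apply: open_nbhs_nbhs; split => //; exact: (open_coordinate n [set y n]).
apply: filterS (filterI IH yn) => z [zy zn] i; rewrite ltnS leq_eqVlt.
by case/predU1P => [->|/zy].
Qed.

Lemma subshift_prefix x y n : subshift x y ->
  exists s, forall i, (i < n)%N -> y i = x (s + i)%N.
Proof.
move=> /(_ _ (nbhs_prefix n y)) [_ [[s _ <-] h]].
by exists s => i ni; rewrite -h // iter_word_shift.
Qed.

Lemma subshift_orbit x n : subshift x (iter n word_shift x).
Proof. by apply: subset_closure; exists n. Qed.

Definition coordinate_cover : set (set (fullshift A)) :=
  range (fun a : A => [set y : fullshift A | y 0%N = a]).

Lemma open_cover_coordinate x : open_cover (subshift x) coordinate_cover.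
Proof.
split=> [_ [a _ <-]|y _]; first exact: (open_coordinate 0 [set a]).
by exists [set z : fullshift A | z 0%N = y 0%N] => //; exists (y 0%N).
Qed.

(** The members of the iterated join are exactly the cylinders of words of length [n], and a
    subcover must contain the cylinder of every factor. *)
Lemma complexity_le_cover_number (R : realType) x n :
  (complexity x n)%:R <= cover_number R (subshift x)
    (iterated_join word_shift coordinate_cover n).
Proof.
pose a0 := x 0%N.
have joinP O : iterated_join word_shift coordinate_cover n O <->
    exists u : n.-tuple A, O = [set y : fullshift A | forall k : 'I_n, y k = tnth u k].
  split=> [[F FU ->]|[u ->]].
    have /choice[g gF] i : exists a : A, (i < n)%N -> F i = [set y : fullshift A | y 0%N = a].
      by case: (ltnP i n) => [/FU[a _ <-]|]; [exists a | exists a0].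
    exists [tuple g i | i < n]; apply/seteqP; split=> y yO.
      move=> k; have := yO k (ltn_ord k); rewrite /= gF // tnth_mktuple /=.
      by rewrite iter_word_shift addn0.
    move=> i /= ni; rewrite gF //= iter_word_shift addn0.
    by have := yO (Ordinal ni); rewrite tnth_mktuple.
  exists (fun i => [set y : fullshift A | y 0%N = nth a0 u i]).
    by move=> i _; exists (nth a0 u i).
  apply/seteqP; split=> y yO.
    by move=> i /= ni; rewrite iter_word_shift addn0 (yO (Ordinal ni)) (tnth_nth a0).
  by move=> k; have := yO k (ltn_ord k); rewrite /= iter_word_shift addn0 (tnth_nth a0).
apply: lb_le_inf.
  (* The infimum needs one finite subcover: all cylinders of length [n]. *)
  exists #|{: n.-tuple A}|%:R; exists #|{: n.-tuple A}| => //.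
  exists (fun i => [set y : fullshift A | forall k : 'I_n, y k = tnth (enum_val i) k]).
  split=> [i|y _]; first by apply/joinP; exists (enum_val i).
  exists (enum_rank [tuple y k | k < n]) => //= k.
  by rewrite enum_rankK tnth_mktuple.
move=> _ [k [F [FU Fcov]] <-]; rewrite ler_nat.
have /choice[v vF] i := (joinP _).1 (FU i).
rewrite /complexity -[leqRHS]card_ord; apply: leq_trans (leq_image_card v _).
apply/subset_leq_card/fintype.subsetP => u; rewrite inE => /is_factorP[s us].
have [i _] := Fcov _ (@subshift_orbit x s); rewrite vF => vi.
apply/fintype.imageP; exists i => //; apply: eq_from_tnth => j.
by rewrite -vi iter_word_shift us.
Qed.

Lemma limn_esup_ge (R : realType) (u : nat -> \bar R) (l : \bar R) :
  (\forall n \near \oo, l <= u n)%E -> (l <= limn_esup u)%E.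
Proof.
move=> [N _ lu]; apply: le_ereal_inf_tmp => _ [V [M _ MV] <-].
apply: (@le_trans _ _ (u (maxn M N))).
  by apply: lu; rewrite /= leq_maxr.
by apply: ereal_sup_ubound; exists (maxn M N) => //; apply: MV; rewrite /= leq_maxl.
Qed.

Lemma topological_entropy_ge (R : realType) x (h : R) :
  (forall n, (0 < n)%N -> h <= n%:R^-1 * ln (complexity x n)%:R) ->
  (h%:E <= topological_entropy R (subshift x) word_shift)%E.
Proof.
move=> hn; apply: (@le_trans _ _ (cover_entropy R (subshift x) word_shift coordinate_cover)).
  apply: limn_esup_ge; exists 1%N => // n /= n0; rewrite lee_fin (le_trans (hn _ n0)) //.
  have c0 : 0 < (complexity x n)%:R :> R by rewrite ltr0n complexity_gt0.
  have cn := complexity_le_cover_number R x n.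
  by rewrite ler_wpM2l ?invr_ge0 // ler_ln ?posrE // (lt_le_trans c0).
by apply: ereal_sup_ubound; exists coordinate_cover => //; exact: open_cover_coordinate.
Qed.

End Cylinders.

(** * Pure discrete spectrum *)

Section SquaredNorm.
Context {R : realType}.
Implicit Types z w : R[i].

Lemma sqnormc_ge0 z : 0 <= sqnormc z.
Proof. by rewrite addr_ge0 // sqr_ge0. Qed.

Lemma sqnormcM z w : sqnormc (z * w) = sqnormc z * sqnormc w.
Proof. by case: z w => a b [c d]; rewrite /sqnormc /=; ring. Qed.

Lemma sqnormcX z n : sqnormc (z ^+ n) = sqnormc z ^+ n.
Proof.
elim: n => [|n IH]; first by rewrite !expr0 /sqnormc /=; ring.
by rewrite !exprS sqnormcM IH.
Qed.

Lemma sqnormcD_le z w : sqnormc (z + w) <= 2 * (sqnormc z + sqnormc w).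
Proof.
case: z w => a b [c d]; rewrite /sqnormc /=.
rewrite -subr_ge0 (_ : _ - _ = (a - c) ^+ 2 + (b - d) ^+ 2); last by ring.
by rewrite addr_ge0 // sqr_ge0.
Qed.

Lemma sqnormc_eq0 z : (sqnormc z == 0) = (z == 0).
Proof. by case: z => a b; rewrite /sqnormc /= paddr_eq0 ?sqr_ge0 // !sqrf_eq0 eq_complex. Qed.

Lemma sqnormc_sum_le n (z : 'I_n -> R[i]) :
  sqnormc (\sum_(k < n) z k) <= 2 ^+ n * \sum_(k < n) sqnormc (z k).
Proof.
elim: n z => [|n IH] z; first by rewrite !big_ord0 mulr0 /sqnormc /=; nra.
rewrite !big_ord_recl (le_trans (sqnormcD_le _ _)) // exprS -mulrA ler_pM2l //.
rewrite mulrDr lerD ?IH // ler_peMl ?sqnormc_ge0 //.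
by rewrite exprn_ege1 // ler1n.
Qed.

(** Decompose [u - v] as [(u - w) - (v - t) + (w - t)] and apply the Cauchy-Schwarz inequality to
    three terms. *)
Lemma sqnormc_le3 u v w t :
  sqnormc (u - v) <= 3 * (sqnormc (u - w) + sqnormc (v - t) + sqnormc (w - t)).
Proof.
case: u v w t => a a' [b b'] [c c'] [d d']; rewrite /sqnormc /=.
suff h (p q r s : R) : (p - q) ^+ 2 <= 3 * ((p - r) ^+ 2 + (q - s) ^+ 2 + (r - s) ^+ 2).
  by have := h a b c d; have := h a' b' c' d'; lra.
have key (X Y Z : R) : (X - Y + Z) ^+ 2 <= 3 * (X ^+ 2 + Y ^+ 2 + Z ^+ 2).
  rewrite -subr_ge0 (_ : _ - _ = (X + Y) ^+ 2 + (X - Z) ^+ 2 + (Y + Z) ^+ 2); last by ring.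
  by rewrite !addr_ge0 // sqr_ge0.
by rewrite (_ : p - q = p - r - (q - s) + (r - s)) ?key //; ring.
Qed.

(* Pigeonhole in a grid of mesh [e] on the polydisc. *)
Lemma polydisc_pigeonhole d (delta : R) : 0 < delta -> exists M : nat,
  forall z : 'I_d -> nat -> R[i], (forall k j, sqnormc (z k j) <= 1) ->
  exists j j', [/\ (j < j')%N, (j' <= M)%N & forall k, sqnormc (z k j - z k j') <= delta].
Proof.
(* Real and imaginary parts contribute [e ^+ 2] each; [e <= 1] gives [e ^+ 2 <= e <= delta / 2]. *)
move=> d0; pose e := Num.min 1 (delta / 2).
have e0 : 0 < e by rewrite lt_min ltr01 divr_gt0.
have ed : 2 * e ^+ 2 <= delta.
  have e1 : e <= 1 by rewrite ge_min lexx.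
  have e2 : e <= delta / 2 by rewrite ge_min lexx orbT.
  have : e * e <= e * 1 by rewrite ler_pM2l.
  rewrite expr2; lra.
pose t (r : R) := Num.truncn ((r + 1) / e).
pose B := (Num.truncn (2 / e)).+1.
have tB r : -1 <= r <= 1 -> (t r < B)%N.
  move=> /andP[r1 r2]; rewrite ltnS; apply: le_truncn.
  by rewrite ler_pM2r ?invr_gt0 //; lra.
have t_eq r r' : -1 <= r -> -1 <= r' -> t r = t r' -> (r - r') ^+ 2 <= e ^+ 2.
  move=> r1 r1' tt.
  have a0 : 0 <= (r + 1) / e by apply: divr_ge0; [lra | exact: ltW].
  have a0' : 0 <= (r' + 1) / e by apply: divr_ge0; [lra | exact: ltW].
  have /andP[h1 h2] := truncn_itv a0; have /andP[h1' h2'] := truncn_itv a0'.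
  move: h1 h2 h1' h2'; rewrite -/(t r) -/(t r') tt -natr1 => h1 h2 h1' h2'.
  have : (r + 1) / e - (r' + 1) / e <= 1 by lra.
  have : (r' + 1) / e - (r + 1) / e <= 1 by lra.
  rewrite -!mulrBl !ler_pdivrMr // mul1r => k1 k2.
  by rewrite -subr_ge0 subr_sqr mulr_ge0 //; lra.
(* [Q] lists the cells of the grid; among the indices from [0] to [#|Q|], two have their points in
   the same cell. *)
pose Q := {ffun 'I_d -> 'I_B * 'I_B}; exists #|{: Q}| => z z1.
have itv k j : -1 <= complex.Re (z k j) <= 1 /\ -1 <= complex.Im (z k j) <= 1.
  have := z1 k j; rewrite /sqnormc; move: (complex.Re _) (complex.Im _) => a b ab.
  have := sqr_ge0 a; have := sqr_ge0 b => b0 a0.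
  have le1 (r : R) : r ^+ 2 <= 1 -> -1 <= r <= 1.
    by rewrite -ler_norml -real_normK ?num_real // expr_le1.
  by split; apply: le1; lra.
pose g (j : 'I_#|{: Q}|.+1) : Q := [ffun k =>
  (Ordinal (tB _ (itv k j).1), Ordinal (tB _ (itv k j).2))].
have /injectivePn[j [j' jj' gj]] : ~~ injectiveb g.
  by apply/injectiveP => /leq_card; rewrite card_ord ltnn.
have close k : sqnormc (z k j - z k j') <= delta.
  have := congr1 (fun q : Q => q k) gj; rewrite !ffunE => -[e1 e2].
  have [/andP[a _] /andP[b _]] := itv k j; have [/andP[a' _] /andP[b' _]] := itv k j'.
  have := t_eq _ _ a a' e1; have := t_eq _ _ b b' e2; rewrite /sqnormc.
  by case: (z k j) (z k j') => ? ? [? ?] /=; lra.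
have closeC k : sqnormc (z k j' - z k j) <= delta.
  by rewrite -opprB; have := close k; case: (_ - _) => ? ?; rewrite /sqnormc /= !sqrrN.
case: (ltngtP j j') => [lt|lt|/val_inj e1]; last by rewrite e1 eqxx in jj'.
  by exists j, j'; split => //; rewrite -ltnS.
by exists j', j; split => //; rewrite -ltnS.
Qed.

End SquaredNorm.

(** * Eigenvalues and recurrence of the Koopman operator *)

Section Koopman.
Context {R : realType} {d : measure_display} {T : measurableType d}.
Variables (mu : probability T R) (S : T -> T).
Hypothesis mS : measurable_fun setT S.
Hypothesis muS : invariant_measure mu S.
Implicit Types f g h : T -> R[i].

Definition cmeasurable f :=
  measurable_fun setT (fun y => complex.Re (f y)) /\
  measurable_fun setT (fun y => complex.Im (f y)).

Definition sqnorm2 f : \bar R := (\int[mu]_y (sqnormc (f y))%:E)%E.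

Lemma cmeasurableB f g : cmeasurable f -> cmeasurable g ->
  cmeasurable (fun y => f y - g y).
Proof.
move=> [f1 f2] [g1 g2]; split.
  rewrite (_ : (fun _ => _) = (fun y => complex.Re (f y) - complex.Re (g y))).
    exact: measurable_funB.
  by apply/funext => y; case: (f y) (g y) => ? ? [].
rewrite (_ : (fun _ => _) = (fun y => complex.Im (f y) - complex.Im (g y))).
  exact: measurable_funB.
by apply/funext => y; case: (f y) (g y) => ? ? [].
Qed.

Lemma cmeasurableZ c f : cmeasurable f -> cmeasurable (fun y => c * f y).
Proof.
move=> [f1 f2]; split.
  rewrite (_ : (fun _ => _) = (fun y => complex.Re c * complex.Re (f y) -
      complex.Im c * complex.Im (f y))).
    by apply: measurable_funB; apply: measurable_funM.
  by apply/funext => y; case: c (f y) => ? ? [].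
rewrite (_ : (fun _ => _) = (fun y => complex.Re c * complex.Im (f y) +
    complex.Im c * complex.Re (f y))).
  by apply: measurable_funD; apply: measurable_funM.
by apply/funext => y; case: c (f y) => ? ? [].
Qed.

Lemma cmeasurable_sum n (g : 'I_n -> T -> R[i]) : (forall k, cmeasurable (g k)) ->
  cmeasurable (fun y => \sum_(k < n) g k y).
Proof.
move=> mg; split.
  rewrite (_ : (fun _ => _) = (fun y => \sum_(k < n) complex.Re (g k y))).
    by apply: measurable_sum => k; case: (mg k).
  by apply/funext => y; elim/big_rec2: _ => // k a b _ <-; case: (g k y) b => ? ? [].
rewrite (_ : (fun _ => _) = (fun y => \sum_(k < n) complex.Im (g k y))).
  by apply: measurable_sum => k; case: (mg k).
by apply/funext => y; elim/big_rec2: _ => // k a b _ <-; case: (g k y) b => ? ? [].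
Qed.

Lemma measurable_iter n : measurable_fun setT (iter n S).
Proof.
elim: n => [|n IH]; first exact: measurable_id.
exact: measurableT_comp mS IH.
Qed.

Lemma cmeasurable_comp f n : cmeasurable f -> cmeasurable (f \o iter n S).
Proof.
by move=> [f1 f2]; split;
  [apply: (measurableT_comp f1) | apply: (measurableT_comp f2)]; exact: measurable_iter.
Qed.

Lemma measurable_sqnormc f : cmeasurable f ->
  measurable_fun setT (fun y => (sqnormc (f y))%:E).
Proof.
move=> [f1 f2]; apply/measurable_EFinP.
by apply: measurable_funD; apply: measurable_funX.
Qed.

Lemma ge0_integral_invariant (F : T -> \bar R) n : measurable_fun setT F ->
  (forall y, 0 <= F y)%E -> (\int[mu]_y F (iter n S y) = \int[mu]_y F y)%E.
Proof.
move=> mF F0; elim: n => [//|n <-].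
have mFn : measurable_fun setT (F \o iter n S).
  by apply: measurableT_comp mF _; exact: measurable_iter.
have := @ge0_integral_pushforward _ _ _ _ _ _ mS mu setT (F \o iter n S)
  measurableT mFn (fun y _ => F0 _).
rewrite preimage_setT.
rewrite (@eq_measure_integral _ _ _ _ mu (pushforward mu S)); last first.
  by move=> B mB _; exact: muS.
by move=> ->; apply: eq_integral => y _ /=; rewrite -iterSr.
Qed.

Lemma sqnorm2_iter f n : cmeasurable f -> sqnorm2 (f \o iter n S) = sqnorm2 f.
Proof.
move=> mf; apply: (ge0_integral_invariant n (measurable_sqnormc mf)) => y.
by rewrite lee_fin sqnormc_ge0.
Qed.

Lemma ae_iter (P : T -> Prop) n : {ae mu, forall y, P y} ->
  {ae mu, forall y, P (iter n S y)}.
Proof.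
elim: n => // n IH /IH [B [mB B0 PB]]; exists (S @^-1` B); split.
- by rewrite -[X in measurable X]setTI; exact: mS.
- by rewrite muS.
- by move=> y /= h; apply: PB => /=; rewrite -iterSr.
Qed.

Lemma sqnorm2_fin f : L2C mu f -> exists r : R, 0 <= r /\ sqnorm2 f = r%:E.
Proof.
move=> [_ _ h].
have h0 : (0 <= sqnorm2 f)%E by apply: integral_ge0 => y _; rewrite lee_fin sqnormc_ge0.
exists (fine (sqnorm2 f)); split; first exact: fine_ge0.
by rewrite fineK // ge0_fin_numE.
Qed.

(** The Koopman operator is an isometry, and the norm of an eigenfunction is finite and non-zero. *)
Lemma eigenvalue_sqnormc lambda f : eigenfunction mu S lambda f -> sqnormc lambda = 1.
Proof.
move=> [Lf f0 fS]; have [m1 m2 _] := Lf; have mf : cmeasurable f by [].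
have [r [r0 fr]] := sqnorm2_fin Lf.
have e : sqnorm2 f = ((sqnormc lambda)%:E * sqnorm2 f)%E.
  rewrite -{1}(sqnorm2_iter 1 mf) /sqnorm2 -ge0_integralZl_EFin ?sqnormc_ge0 //.
  - apply: ge0_ae_eq_integral => //.
    + exact/measurable_sqnormc/(cmeasurable_comp 1 mf).
    + apply: measurable_funeM; exact: measurable_sqnormc.
    + by move=> y _; rewrite lee_fin sqnormc_ge0.
    + by move=> y _; rewrite -EFinM lee_fin mulr_ge0 ?sqnormc_ge0.
    + by apply: filterS fS => y fy _ /=; rewrite fy sqnormcM EFinM.
  - by move=> y _; rewrite lee_fin sqnormc_ge0.
  - exact: measurable_sqnormc.
have [r0'|r0'] := eqVneq r 0.
  exfalso; apply: f0.
  have := (ae_eq_integral_abs mu measurableT (measurable_sqnormc mf)).1.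
  rewrite (eq_integral (fun y => (sqnormc (f y))%:E)); last first.
    by move=> y _; rewrite /= ger0_norm ?sqnormc_ge0.
  rewrite -/(sqnorm2 f) fr r0' => /(_ erefl) h.
  apply: filterS h => y /(_ I) /= [] /eqP; rewrite sqnormc_eq0; exact: eqP.
move: e; rewrite fr -EFinM => -[] e; apply: (mulIf r0').
by rewrite mul1r -e.
Qed.

Lemma eigenfunction_iter lambda f n : eigenfunction mu S lambda f ->
  {ae mu, forall y, f (iter n S y) = lambda ^+ n * f y}.
Proof.
move=> [_ _ fS]; elim: n => [|n IH]; first by apply: aeW => y; rewrite mul1r.
apply: filterS2 IH (ae_iter n fS) => y e1 e2.
by rewrite iterS e2 e1 mulrA -exprS.
Qed.

Lemma sqnorm2_sub_iter f a b : cmeasurable f -> (a <= b)%N ->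
  sqnorm2 (fun y => f (iter a S y) - f (iter b S y)) =
  sqnorm2 (fun y => f y - f (iter (b - a) S y)).
Proof.
move=> mf ab; rewrite -[RHS](sqnorm2_iter a).
  by apply: eq_integral => y _ /=; rewrite -iterD subnK.
by apply: cmeasurableB => //; exact: cmeasurable_comp.
Qed.

(* The orbit of [f] under the Koopman operator is totally bounded, because it
   stays close to the orbit of a finite combination of eigenfunctions, on which
   the operator acts as a rotation of a torus. *)
Lemma pure_discrete_near_return f (eps : R) : pure_discrete_spectrum mu S ->
  L2C mu f -> 0 < eps -> exists M : nat, forall L : nat, exists q : nat,
  [/\ (0 < q)%N, (q <= M)%N &
    (sqnorm2 (fun y => (f y - f (iter (q * L) S y))%R) < eps%:E)%E].
Proof.
move=> pds Lf eps0.
have mf : cmeasurable f by case: Lf.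
(* Two approximation errors, times the factor [3] of [sqnormc_le3], stay below [eps / 2]; [delta] is
   chosen so that the rotation takes at most the other half. *)
have [n [g [c [eig]]]] := pds f Lf (eps / 12) ltac:(by rewrite divr_gt0).
have /choice[lam eigl] := eig.
have Lg k : L2C mu (g k) by case: (eigl k).
have mg k : cmeasurable (g k) by case: (Lg k).
have /choice[r rP] k := sqnorm2_fin (Lg k).
pose h y := \sum_(k < n) c k * g k y.
have mh : cmeasurable h by apply: cmeasurable_sum => k; exact: cmeasurableZ.
rewrite -/h -[X in (X < _)%E]/(sqnorm2 (fun y => f y - h y)%R) => fh.
pose V := \sum_(k < n) sqnormc (c k) * r k.
have V0 : 0 <= V by apply: sumr_ge0 => k _; rewrite mulr_ge0 ?sqnormc_ge0 //; case: (rP k).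
(* The summand [1] allows division by [W] even if [V = 0]. *)
pose W := 3 * 2 ^+ n * V + 1.
have W0 : 0 < W by rewrite ltr_wpDl // !mulr_ge0 // exprn_ge0.
pose delta := eps / 2 / W.
have delta0 : 0 < delta by rewrite !divr_gt0.
have [M hM] := polydisc_pigeonhole n delta0; exists M => L.
(* The pigeonhole is uniform over sequences in the polydisc, so [M] can be fixed before [L]; it is
   applied to powers of the eigenvalues, which have modulus one. *)
have [|j [j' [jj' j'M close]]] := hM (fun k j => lam k ^+ (j * L)).
  by move=> k j; rewrite sqnormcX (eigenvalue_sqnormc (eigl k)) expr1n.
exists (j' - j)%N; split; [by rewrite subn_gt0|by rewrite (leq_trans (leq_subr _ _))|].
rewrite mulnBl -sqnorm2_sub_iter ?leq_mul2r ?(ltnW jj') ?orbT //.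
set a := (j * L)%N; set b := (j' * L)%N.
have msn e f1 f2 : cmeasurable f1 -> cmeasurable f2 ->
    measurable_fun setT (fun y => (sqnormc (f1 (iter e S y) - f2 (iter e S y)))%:E).
  by move=> m1 m2; apply/measurable_sqnormc/cmeasurableB; exact: cmeasurable_comp.
pose G y := \sum_(k < n) sqnormc (c k) * sqnormc (g k y).
have mG : measurable_fun setT (fun y => (G y)%:E).
  apply/measurable_EFinP/measurable_sum => k; apply: measurable_funM => //.
  exact/measurable_EFinP/measurable_sqnormc.
have G0 y : 0 <= G y by apply: sumr_ge0 => k _; rewrite mulr_ge0 ?sqnormc_ge0.
have intG : (\int[mu]_y (G y)%:E = V%:E)%E.
  under eq_integral => y _ do rewrite /G -sumEFin.
  rewrite ge0_integral_sum //; first last.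
  - by move=> k y _; rewrite lee_fin mulr_ge0 ?sqnormc_ge0.
  - move=> k; apply/measurable_EFinP; apply: measurable_funM => //.
    exact/measurable_EFinP/measurable_sqnormc.
  rewrite /V -sumEFin; apply: eq_bigr => k _.
  under eq_integral => y _ do rewrite EFinM.
  rewrite ge0_integralZl_EFin ?sqnormc_ge0 //.
  - by rewrite -/(sqnorm2 (g k)) (rP k).2.
  - by move=> y _; rewrite lee_fin sqnormc_ge0.
  - exact: measurable_sqnormc.
have ae_bound : {ae mu, forall y, (sqnormc (f (iter a S y) - f (iter b S y))%R)%:E <=
    3%:E * (((sqnormc (f (iter a S y) - h (iter a S y))%R)%:E +
            (sqnormc (f (iter b S y) - h (iter b S y)))%:E) +
            (2 ^+ n * delta)%:E * (G y)%:E)}%E.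
  have ev : {ae mu, forall y, forall k : 'I_n,
      g k (iter a S y) = lam k ^+ a * g k y /\ g k (iter b S y) = lam k ^+ b * g k y}.
    (* To use the countable intersection [ae_foralln], the finite family is indexed by [nat] with
       the condition [k < n]. *)
    have : {ae mu, forall y, forall k : nat, forall kn : (k < n)%N,
        g (Ordinal kn) (iter a S y) = lam (Ordinal kn) ^+ a * g (Ordinal kn) y /\
        g (Ordinal kn) (iter b S y) = lam (Ordinal kn) ^+ b * g (Ordinal kn) y}.
      apply: ae_foralln => k.
      have [nk|kn] : (n <= k)%N \/ (k < n)%N by case: (ltnP k n); [right|left].
        by apply: aeW => y kn; exfalso; move: kn; rewrite ltnNge nk.
      apply: filterS2 (eigenfunction_iter a (eigl (Ordinal kn)))
        (eigenfunction_iter b (eigl (Ordinal kn))) => y e1 e2 kn'.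
      by rewrite (bool_irrelevance kn' kn).
    by apply: filterS => y hy [k kn]; exact: hy.
  apply: filterS ev => y ev; rewrite -!EFinM lee_fin.
  apply: le_trans (sqnormc_le3 _ _ (h (iter a S y)) (h (iter b S y))) _.
  rewrite ler_pM2l // lerD2l /h -sumrB.
  apply: le_trans (sqnormc_sum_le _) _; rewrite -mulrA ler_pM2l ?exprn_gt0 //.
  rewrite /G mulr_sumr; apply: ler_sum => k _; have [-> ->] := ev k.
  rewrite -mulrBr -mulrBl !sqnormcM mulrCA.
  by rewrite ler_wpM2r ?mulr_ge0 ?sqnormc_ge0 // close.
have sq0 z : (0 <= (sqnormc z)%:E)%E by rewrite lee_fin sqnormc_ge0.
have D0 : 0 <= 2 ^+ n * delta by rewrite mulr_ge0 ?exprn_ge0 // ltW.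
have mDG : measurable_fun setT (fun y => ((2 ^+ n * delta)%:E * (G y)%:E)%E).
  exact: measurable_funeM.
have le1 : (sqnorm2 (fun y => f (iter a S y) - f (iter b S y))%R <=
   3%:E * (sqnorm2 (fun y => f y - h y)%R + sqnorm2 (fun y => f y - h y)%R +
           (2 ^+ n * delta * V)%:E))%E.
  have mfh : cmeasurable (fun y => f y - h y) by exact: cmeasurableB.
  rewrite -{1}(sqnorm2_iter a mfh) -{1}(sqnorm2_iter b mfh) EFinM -intG.
  rewrite -ge0_integralZl_EFin //; last by move=> y _; rewrite lee_fin.
  rewrite /sqnorm2 -ge0_integralD //; [|exact: msn|exact: msn].
  rewrite -ge0_integralD //; first last.
  - by move=> y _; rewrite mule_ge0 // lee_fin.
  - by apply: emeasurable_funD; exact: msn.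
  - by move=> y _; rewrite adde_ge0.
  rewrite -ge0_integralZl_EFin //; first last.
  - by apply: emeasurable_funD => //; apply: emeasurable_funD; exact: msn.
  - by move=> y _; rewrite !adde_ge0 // mule_ge0 // lee_fin.
  apply: ae_ge0_le_integral => //.
  - by apply/measurable_sqnormc/cmeasurableB; exact: cmeasurable_comp.
  - by move=> y _; rewrite mule_ge0 // !adde_ge0 // mule_ge0 // lee_fin.
  - apply: measurable_funeM.
    by apply: emeasurable_funD => //; apply: emeasurable_funD; exact: msn.
  - by apply: filterS ae_bound => y.
apply: le_lt_trans le1 _.
have [s [s0 fhs]] : exists s : R, 0 <= s /\ sqnorm2 (fun y => f y - h y) = s%:E.
  apply: sqnorm2_fin; split; try by case: (cmeasurableB mf mh).
  exact: lt_trans fh (ltry _).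
rewrite fhs -!EFinD -EFinM lte_fin; move: fh; rewrite fhs lte_fin => fh.
have : 3 * (2 ^+ n * delta * V) <= eps / 2.
  have -> : 3 * (2 ^+ n * delta * V) = delta * (3 * 2 ^+ n * V) by ring.
  apply: (@le_trans _ _ (delta * W)); first by rewrite ler_pM2l // lerDl.
  by rewrite /delta divfK // gt_eqF.
lra.
Qed.

End Koopman.

(** * Continuity and measurability of the shift *)

Section BorelShift.

Lemma continuous_shift (X : topologicalType) :
  continuous ((fun y n => y n.+1) :
    prod_topology (fun _ : nat => X) -> prod_topology (fun _ : nat => X)).
Proof.
move=> y; apply/cvg_sup; first exact/fmap_filter/nbhs_filter.
move=> i; move: y; apply/(@continuousP _ (initial_topology (@^~ i))).
move=> _ [B oB <-].
pose f (y : prod_topology (fun _ : nat => X)) : X := y i.+1.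
have cf : continuous f := @proj_continuous nat (fun=> X) i.+1.
exact: ((continuousP f).1 cf B oB).
Qed.

Variable A : alphabetType.

Lemma continuous_word_shift : continuous (@word_shift A).
Proof. exact: (@continuous_shift (discrete_topology A)). Qed.

Lemma borel_open (O : set (fullshift A)) : open O ->
  measurable (O : set (borel_fullshift A)).
Proof. exact: sub_sigma_algebra. Qed.

Lemma borel_closed (F : set (fullshift A)) : closed F ->
  measurable (F : set (borel_fullshift A)).
Proof. by rewrite -openC => /borel_open /measurableC; rewrite setCK. Qed.

Lemma measurable_word_shift :
  measurable_fun setT (@word_shift A : borel_fullshift A -> borel_fullshift A).
Proof.
have := @measurability _ _ (borel_fullshift A) (borel_fullshift A) setT (@word_shift A)
  (@open (fullshift A)) erefl.
apply; move=> _ [B oB <-].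
rewrite setTI; apply: borel_open.
exact: ((continuousP (@word_shift A)).1 continuous_word_shift B oB).
Qed.

End BorelShift.

(** * Failure of recurrence for a letter observable *)

Section NoDiscreteSpectrum.
Context {R : realType}.
Variables (A : alphabetType) (a0 : A) (phi : A -> bool).
Local Notation lev := (lev a0).
Local Notation x := (limit_word a0).
Hypothesis A4 : (3 < #|A|)%N.
Hypothesis phi_nonconst : exists c d, phi c != phi d.
Variable mu : probability (borel_fullshift A) R.
Hypothesis mu_inv : invariant_measure mu word_shift.
Hypothesis mu_supp : mu (subshift x) = 1%E.

Definition letter_observable (y : borel_fullshift A) : R[i] := ((phi (y 0%N))%:R)%:C%C.

Lemma cmeasurable_letter_observable : cmeasurable letter_observable.
Proof.
split; last exact: measurable_cst.
have -> : (fun y => complex.Re (letter_observable y)) =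
    \1_[set y : borel_fullshift A | phi (y 0%N)].
  by apply/funext => y; rewrite indicE mem_setE /=.
apply: measurable_indic; apply: borel_open; exact: (open_coordinate 0 [set a | phi a]).
Qed.

Lemma L2C_letter_observable : L2C mu letter_observable.
Proof.
have [m1 m2] := cmeasurable_letter_observable; split => //.
apply: (@le_lt_trans _ _ (\int[mu]_y (cst 1%E y))%E).
  apply: ge0_le_integral => //.
  - by move=> y _; rewrite lee_fin sqnormc_ge0.
  - exact/measurable_sqnormc/cmeasurable_letter_observable.
  - move=> y _; rewrite lee_fin /sqnormc /= expr0n addr0.
    by case: (phi _); rewrite ?expr1n ?expr0n //= ler01.
rewrite integral_cst // mul1e.
exact: (le_lt_trans (probability_le1 mu measurableT)) (ltry _).
Qed.

Lemma ae_subshift : {ae mu, forall y, subshift x y}.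
Proof.
have mX : measurable (subshift x : set (borel_fullshift A)).
  apply: borel_closed; exact: closed_closure.
exists (~` subshift x); split => //; first exact: measurableC.
by rewrite probability_setC // mu_supp subee.
Qed.

(** By invariance the integral equals its average over [W] iterates, which counts mismatches in a
    window of [y]. Almost every [y] lies in the subshift, so the window also occurs in the limit
    word and [mismatches_lb] applies. *)
Lemma letter_mismatch_lb n q : (0 < q)%N -> (2 * q <= #|lev n|)%N ->
  ((32 * #|A|%:R ^+ 2)^-1%:E <= sqnorm2 mu (fun y =>
    (letter_observable y - letter_observable (iter (q * len (lev n)) word_shift y))%R))%E.
Proof.
move=> q0 qn; set m := (q * len (lev n))%N.
pose W := (2 * len (lev n.+2))%N; pose a : R := 32 * #|A|%:R ^+ 2.
have W0 : (0 < W)%N by rewrite muln_gt0 len_lev_gt0.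
have a0' : 0 < a by rewrite mulr_gt0 // exprn_gt0 // ltr0n; lia.
pose D (y : borel_fullshift A) : R[i] :=
  letter_observable y - letter_observable (iter m word_shift y).
have mD : cmeasurable D.
  apply: cmeasurableB; first exact: cmeasurable_letter_observable.
  exact: (cmeasurable_comp (@measurable_word_shift A) m cmeasurable_letter_observable).
rewrite -[X in (_ <= X)%E]/(sqnorm2 mu D).
have DE i y : sqnormc (D (iter i word_shift y)) = (phi (y i) != phi (y (i + m)%N))%:R.
  rewrite /D /letter_observable -iterD !iter_word_shift !addn0 addnC.
  by case: (phi _); case: (phi _); rewrite /sqnormc /=; ring.
have sumD y : \sum_(i < W) sqnormc (D (iter i word_shift y)) =
    (mismatches phi m W y)%:R.
  by rewrite /mismatches natr_sum; apply: eq_bigr => i _; rewrite DE.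
have msq i : measurable_fun setT (fun y : borel_fullshift A => (sqnormc (D (iter i word_shift y)))%:E).
  exact/measurable_sqnormc/(cmeasurable_comp (@measurable_word_shift A) i mD).
have sq0 i (y : borel_fullshift A) : (0 <= (sqnormc (D (iter i word_shift y)))%:E)%E.
  by rewrite lee_fin sqnormc_ge0.
have intD : (\int[mu]_y (\sum_(i < W) (sqnormc (D (iter i word_shift y)))%:E) =
    W%:R%:E * sqnorm2 mu D)%E.
  rewrite ge0_integral_sum // (eq_bigr (fun=> sqnorm2 mu D)); last first.
    move=> i _; exact: (sqnorm2_iter (@measurable_word_shift A) mu_inv i mD).
  by rewrite sumr_const card_ord mule_natl.
have : ((W%:R / a)%:E <= W%:R%:E * sqnorm2 mu D)%E.
  rewrite -intD.
  have -> : (W%:R / a)%:E = (\int[mu]_y (cst (W%:R / a)%:E y))%E.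
    have mu1 : mu setT = 1%E := probability_setT mu.
    by rewrite integral_cst // [X in (_ * X)%E]mu1 mule1.
  apply: ae_ge0_le_integral => //.
  - by move=> y _; rewrite lee_fin divr_ge0 // ltW.
  - by move=> y _; apply: sume_ge0.
  - exact: emeasurable_sum.
  - have [B [mB B0 XB]] := ae_subshift; exists B; split => // y ny.
    apply: XB => yX; apply: ny => _.
    rewrite sumEFin sumD lee_fin ler_pdivrMr // mulrC.
    (* The last comparison reads the letter at [W - 1 + m]. *)
    have [s ys] := subshift_prefix (W + m) yX.
    have -> : mismatches phi m W y = mismatches phi m W (fun i => x (s + i)%N).
      apply: eq_bigr => i _; have := ltn_ord i => iW.
      by rewrite !ys // ?ltn_add2r // (leq_trans iW) // leq_addr.
    rewrite /a -natrX -!natrM ler_nat.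
    exact: mismatches_lb.
by rewrite EFinM lee_pmul2l // ?lte_fin ?ltr0n.
Qed.

Lemma limit_word_not_discrete : ~ pure_discrete_spectrum mu word_shift.
Proof.
move=> pds; pose a : R := 32 * #|A|%:R ^+ 2.
have ai : 0 < a^-1 by rewrite invr_gt0 mulr_gt0 // exprn_gt0 // ltr0n; lia.
have [M hM] := pure_discrete_near_return (@measurable_word_shift A) mu_inv pds
  L2C_letter_observable ai.
(* As [M] does not depend on [L], the level can be chosen after it, with enough words for every
   [q <= M]. *)
have Mk : (2 * M <= #|lev (2 * M).+1|)%N.
  elim: (2 * M)%N => // k IH; rewrite card_levS.
  have := double_lt_fact (card_lev_gt3 a0 A4 k.+1); lia.
have [q [q0 qM lt_q]] := hM (len (lev (2 * M).+1)).
have qk : (2 * q <= #|lev (2 * M).+1|)%N by apply: leq_trans Mk; rewrite leq_mul2l.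
by have := lt_le_trans lt_q (letter_mismatch_lb q0 qk); rewrite ltxx.
Qed.

End NoDiscreteSpectrum.

(** * The limit word over a large alphabet of ordinals *)

HB.instance Definition _ n := isPointed.Build 'I_n.+1 ord0.

Theorem theorem1p5 (R : realType) :
  exists (A : alphabetType) (x : nat -> A),
    [/\ factor_balanced R x,
        exponential_complexity R x,
        (0 < topological_entropy R (subshift x) word_shift)%E &
        ~ subshift_pure_discrete_spectrum R x].
Proof.
(* Large enough for the growth estimate, while [.+4] guarantees more than three letters. *)
pose N := (Num.truncn (4 * expR 1 : R)).+4.
pose a0 : 'I_N.+1 := ord0.
have large : 4 * expR 1 <= #|'I_N.+1|%:R :> R.
  rewrite card_ord; apply: ltW; apply: lt_le_trans (truncnS_gt _) _.
  by rewrite ler_nat ltnS; do 4!apply: leqW.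
have [h [h0 cvgh lbh]] := @complexity_cvg R 'I_N.+1 a0 large.
exists 'I_N.+1, (limit_word a0); split.
- by apply: factor_balancedP => w; exact: limit_word_balanced.
- by exists h.
- by apply: (@lt_le_trans _ _ h%:E); [rewrite lte_fin | exact: topological_entropy_ge].
- move=> [mu [mu_inv mu_supp pds]].
  (* The coding that singles out [a0] is not constant, since [ord_max] differs from [a0]. *)
  apply: (@limit_word_not_discrete R 'I_N.+1 a0 (pred1 a0) _ _ mu) pds => //.
    by rewrite card_ord.
  by exists a0, ord_max; rewrite /= ?eqxx.
Qed.
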